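(* Let $G$ be a simple graph such that both $G$ and its complement $\overline{G}$ are connected. Then $$W(G) + W(\overline{G}) \le \binom{n(G)}{2} + \frac{1}{2}\left[(n(G)-1)\left(\varepsilon(G) + \varepsilon(\overline{G})\right) - \xi^c(\overline{G}) - \xi^c(G)\right].$$
   Context: All graphs are finite and simple. $n(G)$ denotes the number of vertices of $G$. For a connected graph $H$, $d_H(u,v)$ is the number of edges on a shortest $u,v$-path; the Wiener index is $W(H)=\sum_{\{u,v\}\subseteq V(H)} d_H(u,v)$ (sum over unordered pairs of vertices); the eccentricity of a vertex $v$ is $\varepsilon_H(v)=\max_{u\in V(H)} d_H(v,u)$; the eccentricity of the graph is $\varepsilon(H)=\sum_{v\in V(H)}\varepsilon_H(v)$; and the eccentric connectivity is $\xi^c(H)=\sum_{v\in V(H)}\deg_H(v)\,\varepsilon_H(v)$. *)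

(* Defs.v *)
From mathcomp Require Import all_boot all_order all_algebra.

Set Implicit Arguments.
Unset Strict Implicit.
Unset Printing Implicit Defensive.

(* A finite simple graph is a symmetric irreflexive relation e : rel T on a
   finType T of vertices. *)

Definition compl_rel (T : finType) (e : rel T) : rel T :=
  [rel u v | (u != v) && ~~ e u v].

Definition graph_connected (T : finType) (e : rel T) : Prop :=
  forall u v : T, connect e u v.

Definition deg (T : finType) (e : rel T) (v : T) : nat := #|[set u | e v u]|.

(* There is a u,v-path (no repeated vertex) with exactly k edges: u :: p lists
   its k.+1 vertices. *)
Definition has_path (T : finType) (e : rel T) (u v : T) (k : nat) : bool :=
  [exists p : k.-tuple T, [&& path e u p, last u p == v & uniq (u :: p)]].

(* A path has fewer than #|T| edges, so the minimum is over all u,v-paths; the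
   default #|T| is the value only when v is not reachable from u. *)
Definition dist (T : finType) (e : rel T) (u v : T) : nat :=
  \big[minn/#|T|]_(k < #|T| | has_path e u v k) (k : nat).

(* Ordering the vertices by enum_rank selects each unordered pair of distinct
   vertices exactly once. *)
Definition wiener (T : finType) (e : rel T) : nat :=
  \sum_(u : T) \sum_(v : T | enum_rank u < enum_rank v) dist e u v.

Definition ecc (T : finType) (e : rel T) (v : T) : nat :=
  \max_(u : T) dist e v u.

Definition graph_ecc (T : finType) (e : rel T) : nat :=
  \sum_(v : T) ecc e v.

Definition ecc_connectivity (T : finType) (e : rel T) : nat :=
  \sum_(v : T) deg e v * ecc e v.

(* Main.v *)
(* In each ordered pair of distinct vertices of G, an adjacent pair contributes
   1 to the distance sum and a non-adjacent pair (u, v) at most the eccentricity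
   of u; hence 2 W(G) <= sum_u (deg_G u + deg_Gc u * ecc_G u).  Adding the same
   bound for the complement Gc and using deg_G u + deg_Gc u = n - 1 gives the
   inequality. *)
Require Import Defs.
From mathcomp Require Import all_boot all_order all_algebra.
From mathcomp Require Import lra.
Import Order.TTheory GRing.Theory Num.Theory.
Local Open Scope ring_scope.

Lemma has_path_sym (T : finType) (e : rel T) (u v : T) (k : nat) :
  symmetric e -> has_path e u v k -> has_path e v u k.
Proof.
move=> e_sym /existsP[p /and3P[e_p /eqP last_p uniq_p]].
(* Traversed backwards, [u :: p] starts at its last vertex and continues with [rev (belast u p)]. *)
have sz : size (rev (belast u p)) == k by rewrite size_rev size_belast size_tuple.
apply/existsP; exists (Tuple sz); rewrite -{}last_p /=; apply/and3P; split.
- by rewrite rev_path; under eq_path => x y do rewrite e_sym.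
- by rewrite -(last_cons u) -rev_rcons -lastI rev_cons last_rcons.
- by rewrite -[_ && _]/(uniq (_ :: _)) -rev_rcons -lastI rev_uniq.
Qed.

Lemma dist_sym (T : finType) (e : rel T) (u v : T) :
  symmetric e -> dist e u v = dist e v u.
Proof.
move=> e_sym; apply: eq_bigl => k.
by apply/idP/idP; apply: has_path_sym.
Qed.

Lemma dist_le_ecc (T : finType) (e : rel T) (u v : T) : (dist e u v <= ecc e u)%N.
Proof. exact: (leq_bigmax (F := dist e u)). Qed.

Lemma dist_adjacent (T : finType) (e : rel T) (u v : T) :
  u != v -> e u v -> (dist e u v <= 1)%N.
Proof.
move=> neq_uv e_uv.
(* The minimum in [dist] ranges over [k < #|T|], so length 1 is a candidate only once two vertices
   are known. *)
have T_gt1 : (1 < #|T|)%N by apply/card_gt1P; exists u, v.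
have path1 : has_path e u v (Ordinal T_gt1).
  by apply/existsP; exists [tuple v]; rewrite /= e_uv eqxx inE neq_uv.
rewrite /dist -minEnat -leEnat.
exact: (bigmin_le_cond _ (fun k : 'I_#|T| => k : nat) path1).
Qed.

(** Ordered pairs split by which vertex has the smaller rank; swapping the two vertices exchanges
    the halves and preserves [dist]. *)
Lemma double_wiener (T : finType) (e : rel T) : symmetric e ->
  (2 * wiener e = \sum_(u : T) \sum_(v : T | v != u) dist e u v)%N.
Proof.
move=> e_sym.
have -> : (\sum_(u : T) \sum_(v : T | v != u) dist e u v =
           \sum_(u : T) (\sum_(v : T | enum_rank u < enum_rank v) dist e u v +
                         \sum_(v : T | enum_rank v < enum_rank u) dist e u v))%N.
  apply: eq_bigr => u _.
  rewrite (bigID (fun v => enum_rank u < enum_rank v)%N) /=.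
  congr (_ + _)%N; apply: eq_bigl => v;
    by rewrite -(inj_eq enum_rank_inj) -val_eqE /=; case: ltngtP.
rewrite big_split /= mul2n -addnn; congr (_ + _)%N.
rewrite (exchange_big_dep predT) //=.
by do 2![apply: eq_bigr => ? _]; rewrite dist_sym.
Qed.

(** Neighbours and non-neighbours of [u] exhaust the vertices other than [u]; the successor counts
    [u] itself. *)
Lemma deg_compl (T : finType) (e : rel T) (u : T) : irreflexive e ->
  (deg e u + deg (compl_rel e) u).+1 = #|T|.
Proof.
move=> e_irr; rewrite -(cardsC [set v | e u v]) -addnS; congr addn.
rewrite (cardsD1 u (~: _)) !inE e_irr; congr _.+1.
by apply: eq_card => v; rewrite !inE /= eq_sym.
Qed.

Lemma double_wiener_le (T : finType) (e : rel T) :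
  symmetric e -> irreflexive e ->
  (2 * wiener e <= \sum_(u : T) (deg e u + deg (compl_rel e) u * ecc e u))%N.
Proof.
move=> e_sym e_irr; rewrite double_wiener //; apply: leq_sum => u _.
rewrite (bigID (e u)) /= leq_add //.
  apply: (@leq_trans (\sum_(v | (v != u) && e u v) 1)%N).
    by apply: leq_sum => v /andP[neq_vu e_uv]; rewrite dist_adjacent // eq_sym.
  rewrite sum1_card; apply: subset_leq_card.
  by apply/subsetP => v; rewrite !inE => /andP[].
apply: (@leq_trans (\sum_(v | (v != u) && ~~ e u v) ecc e u)%N).
  by apply: leq_sum => v _; apply: dist_le_ecc.
rewrite sum_nat_const leq_mul2r subset_leq_card ?orbT //.
by apply/subsetP => v; rewrite inE unfold_in /compl_rel /= eq_sym.
Qed.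

(** A weighted sum of [deg_compl]; the extra [f u] avoids truncated subtraction in [n - 1]. *)
Lemma sum_deg_compl (T : finType) (e : rel T) (f : T -> nat) :
  irreflexive e ->
  (\sum_(u : T) (deg e u * f u + deg (compl_rel e) u * f u + f u) =
   #|T| * \sum_(u : T) f u)%N.
Proof.
move=> e_irr; rewrite big_distrr /=; apply: eq_bigr => u _.
by rewrite -mulnDl addnC -mulSn deg_compl.
Qed.

Lemma compl_rel_sym (T : finType) (e : rel T) :
  symmetric e -> symmetric (compl_rel e).
Proof. by move=> e_sym u v; rewrite /compl_rel /= eq_sym e_sym. Qed.

Lemma compl_rel_irr (T : finType) (e : rel T) : irreflexive (compl_rel e).
Proof. by move=> u; rewrite /compl_rel /= eqxx. Qed.

(** Double complementation can alter only the diagonal, which is empty for irreflexive [e]. *)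
Lemma deg_compl_rel_compl (T : finType) (e : rel T) (u : T) :
  irreflexive e -> deg (compl_rel (compl_rel e)) u = deg e u.
Proof.
move=> e_irr; apply: eq_card => v; rewrite !inE /compl_rel /= negb_and !negbK.
by case: eqP => [->|_] //=; rewrite e_irr.
Qed.

Theorem corollary2p4 (T : finType) (e : rel T)
  (e_sym : symmetric e) (e_irr : irreflexive e)
  (G_conn : graph_connected e) (Gc_conn : graph_connected (compl_rel e)) :
  ((wiener e)%:R + (wiener (compl_rel e))%:R : rat) <=
    'C(#|T|, 2)%:R +
    2%:R^-1 * ((#|T|%:R - 1) *
                 ((graph_ecc e)%:R + (graph_ecc (compl_rel e))%:R)
               - (ecc_connectivity (compl_rel e))%:R
               - (ecc_connectivity e)%:R).
Proof.
have := double_wiener_le _ _ e_sym e_irr.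
have := double_wiener_le _ _ (compl_rel_sym _ _ e_sym) (compl_rel_irr _ e).
under eq_bigr => u _ do rewrite deg_compl_rel_compl //.
(* Weight 1 evaluates the total of all degrees in both graphs; the eccentricity weights below turn
   the mixed sums, degree in one graph times eccentricity in the other, into [ecc_connectivity]
   terms. *)
have := sum_deg_compl _ _ (fun=> 1%N) e_irr.
have := sum_deg_compl _ _ (ecc e) e_irr.
have := sum_deg_compl _ _ (ecc (compl_rel e)) e_irr.
rewrite !big_split -!big_distrl /= !muln1 !sum1_card.
rewrite -!/(graph_ecc _) -!/(ecc_connectivity _).
have : (#|T| * #|T| = 2 * 'C(#|T|, 2) + #|T|)%N.
  (* The case split covers [#|T| = 0], where [#|T|.-1.+1] differs from [#|T|]. *)
  by rewrite -mul_bin_diag bin1 -mulnSr; case: #|T|.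
have natQ m n : m = n -> m%:R = n%:R :> rat by move=> ->.
(* Over [rat] everything is linear once the products with [#|T|] and the mixed sums count as
   atoms. *)
move=> /natQ + /natQ + /natQ + /natQ; rewrite -!(ler_nat rat) !natrD !natrM.
lra.
Qed.
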